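(* Let $N\ge2$ and let $k\ge 2$ be an integer. Let $u$ be a vector in the closed ball $B_k^N$ of $\mathbb{R}^N$ centred at the origin with radius $k$. Then $u$ can be written as the sum of $k$ vectors of the unit sphere $\mathcal{S}^{N-1}$: there exist $u_1,\dots,u_k\in\mathcal{S}^{N-1}$ with $$u=\sum_{i=1}^k u_i.$$ Equivalently, every $u$ in the closed unit ball $B_1^N$ of $\mathbb{R}^N$ can, for every integer $k\ge2$, be written as the average of $k$ vectors of $\mathcal{S}^{N-1}$: $u=\frac1k\sum_{i=1}^k u_i$ with $u_i\in\mathcal{S}^{N-1}$.
   Context: $\mathcal{S}^{N-1}$ denotes the unit sphere $\{x\in\mathbb{R}^N:|x|=1\}$, with $|\cdot|$ the Euclidean norm. *)

(* Defs.v *)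
From mathcomp Require Import all_boot all_order all_algebra.
From mathcomp Require Import classical_sets reals.

Set Implicit Arguments.
Unset Strict Implicit.
Unset Printing Implicit Defensive.

Import Order.TTheory GRing.Theory Num.Theory.

Local Open Scope classical_set_scope.
Local Open Scope ring_scope.

(* MathComp-Analysis equips 'rV[R]_N with the sup norm, so that the `|x| and
   closed_ball of the library are not the Euclidean ones. *)
Definition enorm (R : realType) (N : nat) (x : 'rV[R]_N) : R :=
  Num.sqrt (\sum_(i < N) x ord0 i ^+ 2).

Definition unit_sphere (R : realType) (N : nat) : set 'rV[R]_N :=
  [set x | enorm x = 1].

Definition cball0 (R : realType) (N : nat) (r : R) : set 'rV[R]_N :=
  [set x | enorm x <= r].

Arguments unit_sphere : clear implicits.
Arguments cball0 {R} N r.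

(* Main.v *)
Require Import Defs.
From mathcomp Require Import all_boot all_order all_algebra.
From mathcomp Require Import classical_sets reals.
From mathcomp Require Import lra.

(** Two unit vectors suffice for a vector of norm at most [2]: such a [u] is the
    diagonal of a rhombus with unit sides, whose other diagonal has any direction
    [w] orthogonal to [u]; that is, [u] is the sum of
    [u/2 + sqrt (1 - |u/2|^2) w] and [u/2 - sqrt (1 - |u/2|^2) w] ([sum_two_unit]).
    This is where dimension at least [2] enters: it provides [w]
    ([unit_orthogonal]).

    More summands are handled by induction on their number ([sum_unit]).
    Subtracting from [u] a unit vector pointing in its direction leaves a vector
    of norm [| |u| - 1 |], which is at most [k] as soon as [|u| <= k + 1] and [1 <= k].

    The statement on averages is the one on sums applied to [k u]. *)

Import Order.TTheory GRing.Theory Num.Theory.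

Local Open Scope classical_set_scope.
Local Open Scope ring_scope.

Lemma enorm_ge0 (R : realType) (N : nat) (x : 'rV[R]_N) : 0 <= enorm x.
Proof. exact: sqrtr_ge0. Qed.

Lemma sqr_enorm (R : realType) (N : nat) (x : 'rV[R]_N) :
  enorm x ^+ 2 = (x *m x^T) 0 0.
Proof.
rewrite sqr_sqrtr ?sumr_ge0// => [|i _]; last exact: sqr_ge0.
by rewrite mxE; apply: eq_bigr => i _; rewrite mxE.
Qed.

Lemma enormZ (R : realType) (N : nat) (a : R) (x : 'rV[R]_N) :
  enorm (a *: x) = `|a| * enorm x.
Proof.
apply/eqP; rewrite -(eqrXn2 (ltn0Sn 1)) ?mulr_ge0 ?enorm_ge0//.
rewrite exprMn real_normK ?num_real// !sqr_enorm.
by rewrite linearZ -scalemxAl -scalemxAr !mxE mulrA -expr2.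
Qed.

Lemma enorm_eq0 (R : realType) (N : nat) (x : 'rV[R]_N) :
  (enorm x == 0) = (x == 0).
Proof.
have sq_ge0 i : true -> 0 <= x 0 i ^+ 2 by rewrite sqr_ge0.
apply/eqP/eqP => [x0|->]; last by rewrite -(scale0r 0) enormZ normr0 mul0r.
have sum0 : \sum_(i < N) x 0 i ^+ 2 = 0.
  by rewrite -[LHS]sqr_sqrtr ?sumr_ge0// -/(enorm x) x0 expr0n.
apply/rowP => i; rewrite mxE; apply/eqP; rewrite -sqrf_eq0; apply/eqP.
exact: (psumr_eq0P sq_ge0 sum0).
Qed.

Lemma enorm_normalize (R : realType) (N : nat) (x : 'rV[R]_N) :
  x != 0 -> enorm ((enorm x)^-1 *: x) = 1.
Proof.
by move=> x0; rewrite enormZ ger0_norm ?invr_ge0 ?enorm_ge0// mulVf ?enorm_eq0.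
Qed.

Lemma pythagoras (R : realType) (N : nat) (x y : 'rV[R]_N) :
  y *m x^T = 0 -> enorm (x + y) ^+ 2 = enorm x ^+ 2 + enorm y ^+ 2.
Proof.
move=> yx0; have xy0 : x *m y^T = 0 by rewrite -[LHS]trmxK trmx_mul trmxK yx0 trmx0.
by rewrite !sqr_enorm linearD /= mulmxDl !mulmxDr yx0 xy0 addr0 add0r mxE.
Qed.

(** The orthogonal complement of [u] is the kernel of a matrix of rank at most
    [1], so it is nonzero in dimension at least [2]. *)
Lemma unit_orthogonal (R : realType) (N : nat) (u : 'rV[R]_N) : (2 <= N)%N ->
  exists2 w : 'rV[R]_N, enorm w = 1 & w *m u^T = 0.
Proof.
move=> N2; pose w := nz_row (kermx u^T).
have wu0 : w *m u^T = 0 by apply/sub_kermxP; exact: nz_row_sub.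
have w0 : w != 0.
  rewrite nz_row_eq0 -mxrank_eq0 mxrank_ker mxrank_tr -lt0n subn_gt0.
  exact: leq_ltn_trans (rank_leq_row u) N2.
exists ((enorm w)^-1 *: w); first exact: enorm_normalize.
by rewrite -scalemxAl wu0 scaler0.
Qed.

Lemma unit_direction (R : realType) (N : nat) (u : 'rV[R]_N) : (2 <= N)%N ->
  exists2 e : 'rV[R]_N, enorm e = 1 & u = enorm u *: e.
Proof.
move=> N2; have [u0|u0] := eqVneq u 0.
  (* The zero vector has every direction; any unit vector will do. *)
  have [e e1 _] := unit_orthogonal _ _ u N2; exists e => //.
  by move/eqP: (u0); rewrite -enorm_eq0 => /eqP ->; rewrite scale0r.
exists ((enorm u)^-1 *: u); first exact: enorm_normalize.
by rewrite scalerA mulfV ?enorm_eq0// scale1r.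
Qed.

(** The two sides of the rhombus with diagonal [u] have the same norm because its
    diagonals are orthogonal. *)
Lemma sum_two_unit (R : realType) (N : nat) (u : 'rV[R]_N) : (2 <= N)%N ->
  enorm u <= 2 ->
  exists v w : 'rV[R]_N, [/\ enorm v = 1, enorm w = 1 & u = v + w].
Proof.
move=> N2 u2; have [w w1 wu0] := unit_orthogonal _ _ u N2.
pose h : 'rV[R]_N := 2^-1 *: u; pose s := Num.sqrt (1 - enorm h ^+ 2).
have s2 : s ^+ 2 = 1 - enorm h ^+ 2.
  rewrite sqr_sqrtr// subr_ge0 expr_le1 ?enorm_ge0//.
  by rewrite enormZ ger0_norm ?invr_ge0// mulrC ler_pdivrMr ?mul1r.
have side a : a ^+ 2 = s ^+ 2 -> enorm (h + a *: w) = 1.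
  move=> a2; apply/eqP; rewrite -(eqrXn2 (ltn0Sn 1)) ?enorm_ge0// expr1n.
  rewrite pythagoras; last first.
    by rewrite linearZ -scalemxAl -scalemxAr wu0 !scaler0.
  by rewrite (enormZ _ _ a) w1 mulr1 real_normK ?num_real// a2 s2 addrC subrK.
exists (h + s *: w), (h + (- s) *: w); split; [exact: side| |].
  by apply: side; rewrite sqrrN.
rewrite scaleNr addrACA subrr addr0 -scalerDl -[LHS]scale1r.
by congr (_ *: _); lra.
Qed.

(** Removing the unit vector [e] in the direction of [u] gives
    [u - e = (|u| - 1) e], whose norm is known exactly. *)
Lemma sum_unit (R : realType) (N : nat) (n : nat) (u : 'rV[R]_N) : (2 <= N)%N ->
  enorm u <= n.+2%:R ->
  exists v : 'I_n.+2 -> 'rV[R]_N,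
    (forall i, enorm (v i) = 1) /\ u = \sum_(i < n.+2) v i.
Proof.
move=> N2; elim: n u => [|n IH] u un.
  have [v [w [v1 w1 ->]]] := sum_two_unit _ _ u N2 un.
  exists (fun i => if i == ord0 then v else w); split=> [i|]; first by case: ifP.
  by rewrite !big_ord_recl big_ord0 addr0.
have [e e1 ue] := unit_direction _ _ u N2.
have ue_n : enorm (u - e) <= n.+2%:R.
  rewrite {1}ue -{2}[e]scale1r -scalerBl enormZ e1 mulr1.
  have := enorm_ge0 _ _ u; move: un; rewrite ler_norml -natr1 -(natr1 n.+1) -(natr1 n).
  by have := ler0n R n; lra.
have [v [v1 uv]] := IH _ ue_n.
exists (fun i => oapp v e (unlift ord0 i)); split=> [i|].
  by case: (unlift _ _) => /=.
rewrite big_ord_recl unlift_none /=; under eq_bigr do rewrite liftK /=.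
by rewrite -uv addrC subrK.
Qed.

Theorem lemma1 (R : realType) (N : nat) (hN : (2 <= N)%N) :
  (forall k : nat, (2 <= k)%N ->
     forall u : 'rV[R]_N, cball0 N k%:R u ->
       exists v : 'I_k -> 'rV[R]_N,
         (forall i : 'I_k, unit_sphere R N (v i)) /\
         u = \sum_(i < k) v i) /\
  (forall u : 'rV[R]_N, cball0 N 1 u ->
     forall k : nat, (2 <= k)%N ->
       exists v : 'I_k -> 'rV[R]_N,
         (forall i : 'I_k, unit_sphere R N (v i)) /\
         u = k%:R^-1 *: \sum_(i < k) v i).
Proof.
split=> [[|[|n]] // _ u un|u u1 [|[|n]] // _]; first exact: sum_unit.
have [|v [v1 uv]] := sum_unit R N n (n.+2%:R *: u) hN.
  by rewrite enormZ normr_nat ler_piMr.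
by exists v; split=> //; rewrite -uv scalerA mulVf ?scale1r// pnatr_eq0.
Qed.
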